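(* Let $\mathbb{K}$ be a field. Then $\mathbb{K}$, considered as a bialgebra over itself, is not a protomodular object in the category $\mathsf{BiAlg}_{\mathbb{K}}$ of all $\mathbb{K}$-bialgebras.
   Context: $\mathsf{BiAlg}_{\mathbb{K}}$ is the category of all (not necessarily cocommutative) $\mathbb{K}$-bialgebras (associative, unital, coassociative, counital), with bialgebra morphisms (algebra and coalgebra maps preserving units and counits). It is a pointed category with finite limits, with zero object $\mathbb{K}$. In a pointed category with finite limits: A split extension over $Y$ is a diagram consisting of morphisms $k\colon K\to X$, $f\colon X\to Y$, $s\colon Y\to X$ such that $k$ is a (categorical) kernel of $f$ and $f\circ s=1_Y$ (it is not required that $f$ be a cokernel of $k$). A pair of arrows $(k\colon K\to X,\ s\colon Y\to X)$ is jointly extremally epimorphic when, for every monomorphism (in the categorical sense) $m\colon M\to X$ such that both $k$ and $s$ factor through $m$, the morphism $m$ is an isomorphism. A split extension $(k,f,s)$ is strong when $(k,s)$ is jointly extremally epimorphic. The pullback of a split extension $(k,f,s)$ over $Y$ along $g\colon W\to Y$ is the split extension over $W$ given by the pullback projection $\pi_1\colon W\times_Y X\to W$, its section $\langle 1_W, s\circ g\rangle$, and the kernel of $\pi_1$. A split extension over $Y$ is stably strong when all of its pullbacks along all morphisms $g\colon W\to Y$ are strong. An object $Y$ is protomodular when all split extensions over $Y$ are stably strong. *)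

(* Defs.v *)
From HB Require Import structures.
From mathcomp Require Import all_boot all_algebra.
From mathcomp Require Import boolp.

Set Implicit Arguments.
Unset Strict Implicit.
Unset Printing Implicit Defensive.

Import GRing.Theory.
Local Open Scope ring_scope.

Reserved Notation "v ⊗ w" (at level 40, left associativity).

(** * Tensor product of two vector spaces

    [tensor V W] is the set of formal finite sums of pairs, encoded as lists
    [:: (v1, w1); ...; (vn, wn)], modulo the congruence generated by
    commutativity and bilinearity; negation is [(v, w) |-> (- v, w)]. *)

Section Tensor.
Variables (K : fieldType) (V W : lmodType K).

Inductive tensor_cong : seq (V * W) -> seq (V * W) -> Prop :=
| tc_refl s : tensor_cong s s
| tc_sym s t : tensor_cong s t -> tensor_cong t s
| tc_trans t s u : tensor_cong s t -> tensor_cong t u -> tensor_cong s u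
| tc_cat s s' t t' :
    tensor_cong s s' -> tensor_cong t t' -> tensor_cong (s ++ t) (s' ++ t')
| tc_catC s t : tensor_cong (s ++ t) (t ++ s)
| tc_0l w : tensor_cong [:: (0, w)] [::]
| tc_Dl v v' w : tensor_cong [:: (v + v', w)] [:: (v, w); (v', w)]
| tc_Dr v w w' : tensor_cong [:: (v, w + w')] [:: (v, w); (v, w')]
| tc_Z a v w : tensor_cong [:: (a *: v, w)] [:: (v, a *: w)].

Definition tensor_rel : rel (seq (V * W)) := fun s t => `[< tensor_cong s t >].

Lemma tensor_rel_refl : reflexive tensor_rel.
Proof. by move=> s; apply/asboolP; exact: tc_refl. Qed.

Lemma tensor_rel_sym : symmetric tensor_rel.
Proof. by move=> s t; apply/asboolP/asboolP => /tc_sym. Qed.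

Lemma tensor_rel_trans : transitive tensor_rel.
Proof.
by move=> t s u /asboolP st /asboolP tu; apply/asboolP; exact: tc_trans tu.
Qed.

Canonical tensor_equiv :=
  EquivRel tensor_rel tensor_rel_refl tensor_rel_sym tensor_rel_trans.

Local Open Scope quotient_scope.

Definition tensor := {eq_quot tensor_equiv}.
HB.instance Definition _ := Choice.on tensor.

Definition tclass (s : seq (V * W)) : tensor := \pi_{eq_quot tensor_equiv} s.

Definition trepr (x : tensor) : seq (V * W) :=
  @repr _ {eq_quot tensor_equiv} x.

Definition pure (v : V) (w : W) : tensor := tclass [:: (v, w)].

Lemma treprK : cancel trepr tclass.
Proof. by move=> x; rewrite /tclass /trepr reprK. Qed.

Lemma tclassP s t : tclass s = tclass t <-> tensor_cong s t.
Proof.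
split; first by move/eqquotP => /asboolP.
by move=> st; apply/eqquotP; apply/asboolP.
Qed.

Lemma trepr_class s : tensor_cong (trepr (tclass s)) s.
Proof. by apply/tclassP; rewrite treprK. Qed.

Definition tscale_seq (a : K) (s : seq (V * W)) := [seq (a *: p.1, p.2) | p <- s].

Definition tadd (x y : tensor) := tclass (trepr x ++ trepr y).
Definition tscale (a : K) (x : tensor) := tclass (tscale_seq a (trepr x)).
Definition topp (x : tensor) := tscale (- 1) x.

Lemma tadd_class s t : tadd (tclass s) (tclass t) = tclass (s ++ t).
Proof. by apply/tclassP; apply: tc_cat; exact: trepr_class. Qed.

Lemma tscale_seq_cong a s t :
  tensor_cong s t -> tensor_cong (tscale_seq a s) (tscale_seq a t).
Proof.
elim=> {s t}.
- by move=> s; exact: tc_refl.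
- by move=> s t _; exact: tc_sym.
- by move=> t s u _ st _; exact: tc_trans.
- by move=> s s' t t' _ IHs _ IHt; rewrite /tscale_seq !map_cat; exact: tc_cat.
- by move=> s t; rewrite /tscale_seq !map_cat; exact: tc_catC.
- by move=> w /=; rewrite scaler0; exact: tc_0l.
- by move=> v v' w /=; rewrite scalerDr; exact: tc_Dl.
- by move=> v w w' /=; exact: tc_Dr.
- by move=> b v w /=; rewrite scalerA mulrC -scalerA; exact: tc_Z.
Qed.

Lemma tscale_class a s : tscale a (tclass s) = tclass (tscale_seq a s).
Proof. by apply/tclassP; apply: tscale_seq_cong; exact: trepr_class. Qed.

Lemma taddA : associative tadd.
Proof.
move=> x y z; rewrite -(treprK x) -(treprK y) -(treprK z).
by rewrite !tadd_class catA.
Qed.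

Lemma taddC : commutative tadd.
Proof.
move=> x y; rewrite -(treprK x) -(treprK y) !tadd_class.
by apply/tclassP; exact: tc_catC.
Qed.

Lemma tadd0 : left_id (tclass [::]) tadd.
Proof. by move=> x; rewrite -(treprK x) tadd_class. Qed.

Lemma tscale_addl x a b : tscale (a + b) x = tadd (tscale a x) (tscale b x).
Proof.
rewrite -(treprK x); elim: (trepr x) => [|p s IHs].
  by rewrite !tscale_class tadd0.
have -> : tclass (p :: s) = tadd (tclass [:: p]) (tclass s) by rewrite tadd_class.
have scD c y z : tscale c (tadd y z) = tadd (tscale c y) (tscale c z).
  rewrite -(treprK y) -(treprK z) tadd_class !tscale_class tadd_class.
  by rewrite /tscale_seq map_cat.
rewrite !scD {}IHs !taddA; congr (tadd _ _).
rewrite -!taddA [tadd (tscale a (tclass s)) _]taddC !taddA; congr (tadd _ _).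
rewrite !tscale_class tadd_class /= scalerDl.
by apply/tclassP; exact: tc_Dl.
Qed.

Lemma tscale0 x : tscale 0 x = tclass [::].
Proof.
rewrite -(treprK x) tscale_class; apply/tclassP.
elim: (trepr x) => [|[v w] s IHs] /=; first exact: tc_refl.
by rewrite scale0r -cat1s -[[::]]cats0; apply: tc_cat => //; exact: tc_0l.
Qed.

Lemma tscale1 : left_id 1 tscale.
Proof.
move=> x; rewrite -(treprK x) tscale_class /tscale_seq.
rewrite (eq_map (g := id)) ?map_id //.
by case=> v w /=; rewrite scale1r.
Qed.

Lemma taddN : left_inverse (tclass [::]) topp tadd.
Proof.
by move=> x; rewrite /topp -{2}(tscale1 x) -tscale_addl addNr tscale0.
Qed.

HB.instance Definition _ := GRing.isZmodule.Build tensor taddA taddC tadd0 taddN.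

Lemma tscaleA a b x : tscale a (tscale b x) = tscale (a * b) x.
Proof.
rewrite -(treprK x) !tscale_class /tscale_seq -map_comp.
by congr tclass; apply: eq_map => -[v w] /=; rewrite scalerA.
Qed.

Lemma tscaleDr : right_distributive tscale +%R.
Proof.
move=> a x y; rewrite -(treprK x) -(treprK y) [_ + _]tadd_class !tscale_class.
by rewrite [RHS]tadd_class /tscale_seq map_cat.
Qed.

Lemma tscaleDl x : {morph tscale^~ x : a b / a + b}.
Proof. by move=> a b; exact: tscale_addl. Qed.

HB.instance Definition _ := GRing.Zmodule_isLmodule.Build K tensor
  tscaleA tscale1 tscaleDr tscaleDl.

Lemma scale_tclass a s : a *: tclass s = tclass (tscale_seq a s).
Proof. exact: tscale_class. Qed.

Lemma add_tclass s t : tclass s + tclass t = tclass (s ++ t).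
Proof. exact: tadd_class. Qed.

Lemma pure_bilinear : bilinear_for *:%R *:%R pure.
Proof.
split=> [w a v v'|v a w w'].
  rewrite /pure /= scale_tclass add_tclass /=.
  by apply/tclassP; exact: tc_Dl.
rewrite /pure /= scale_tclass add_tclass /=.
apply/tclassP; apply: tc_trans (tc_Dr _ _ _) _.
rewrite -cat1s -[X in tensor_cong _ X]cat1s.
by apply: tc_cat; [exact/tc_sym/tc_Z|exact: tc_refl].
Qed.

HB.instance Definition _ :=
  bilinear_isBilinear.Build K V W tensor *:%R *:%R pure pure_bilinear.

Lemma tclassE s : tclass s = \sum_(p <- s) pure p.1 p.2.
Proof.
elim: s => [|[v w] s IHs]; first by rewrite big_nil.
by rewrite big_cons -IHs /pure add_tclass.
Qed.

Lemma tensorE x : x = \sum_(p <- trepr x) pure p.1 p.2.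
Proof. by rewrite -tclassE treprK. Qed.

Lemma tensor_ind (P : tensor -> Prop) :
  P 0 -> (forall x v w, P x -> P (pure v w + x)) -> forall x, P x.
Proof.
move=> P0 PD x; rewrite (tensorE x).
elim: (trepr x) => [|p s IHs]; first by rewrite big_nil.
by rewrite big_cons; exact: PD.
Qed.

(** The linear map out of the tensor product induced by [f].  It is defined
    for every [f], but is meaningful only when [f] is bilinear. *)
Definition tlift (U : lmodType K) (f : V -> W -> U) (x : tensor) : U :=
  \sum_(p <- trepr x) f p.1 p.2.

Section Lift.
Variables (U : lmodType K) (f : V -> W -> U).
Hypothesis f_bil : bilinear_for *:%R *:%R f.

Lemma bilDl v v' w : f (v + v') w = f v w + f v' w.
Proof. by have := f_bil.1 w 1 v v'; rewrite /= !scale1r. Qed.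

Lemma bilDr v w w' : f v (w + w') = f v w + f v w'.
Proof. by have := f_bil.2 v 1 w w'; rewrite /= !scale1r. Qed.

Lemma bil0l w : f 0 w = 0.
Proof. by apply: (addrI (f 0 w)); rewrite -bilDl !addr0. Qed.

Lemma bil0r v : f v 0 = 0.
Proof. by apply: (addrI (f v 0)); rewrite -bilDr !addr0. Qed.

Lemma bilZl a v w : f (a *: v) w = a *: f v w.
Proof. by have := f_bil.1 w a v 0; rewrite /= bil0l !addr0. Qed.

Lemma bilZr a v w : f v (a *: w) = a *: f v w.
Proof. by have := f_bil.2 v a w 0; rewrite /= bil0r !addr0. Qed.

Lemma tlift_class s : tlift f (tclass s) = \sum_(p <- s) f p.1 p.2.
Proof.
suff eq_cong t u : tensor_cong t u ->
  \sum_(p <- t) f p.1 p.2 = \sum_(p <- u) f p.1 p.2.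
  by apply: eq_cong; exact: trepr_class.
elim=> {s t u} //.
- by move=> t s u _ -> _.
- by move=> s s' t t' _ IHs _ IHt; rewrite !big_cat /= IHs IHt.
- by move=> s t; rewrite !big_cat /= addrC.
- by move=> w; rewrite big_cons !big_nil addr0 /= bil0l.
- by move=> v v' w; rewrite !big_cons !big_nil !addr0 /= bilDl.
- by move=> v w w'; rewrite !big_cons !big_nil !addr0 /= bilDr.
- by move=> a v w; rewrite !big_cons !big_nil !addr0 /= bilZl bilZr.
Qed.

Lemma tlift_pure v w : tlift f (pure v w) = f v w.
Proof. by rewrite tlift_class big_seq1. Qed.

Lemma tlift_linear : linear (tlift f).
Proof.
move=> a x y; rewrite -(treprK x) -(treprK y).
rewrite scale_tclass add_tclass !tlift_class.
rewrite big_cat big_map /= scaler_sumr; congr (_ + _).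
by apply: eq_bigr => p _; rewrite bilZl.
Qed.

End Lift.

Lemma tensor_ext (U : lmodType K) (g h : tensor -> U) :
  linear g -> linear h -> (forall v w, g (pure v w) = h (pure v w)) -> g =1 h.
Proof.
move=> gl hl gh x.
have lin0 (k : tensor -> U) : linear k -> k 0 = 0.
  move=> kl; have := kl 1 0 0; rewrite !scale1r addr0.
  by rewrite -[LHS]addr0 => /addrI.
elim/tensor_ind: x => [|x v w IHx]; first by rewrite !lin0.
by have := gl 1 (pure v w) x; have := hl 1 (pure v w) x;
  rewrite !scale1r => -> ->; rewrite gh IHx.
Qed.

End Tensor.

Notation "v ⊗ w" := (pure v w) : ring_scope.

Section TensorMap.
Variable K : fieldType.

(** [tmap f g] is [f ⊗ g], for linear maps [f] and [g]. *)
Definition tmap (V V' W W' : lmodType K) (f : V -> V') (g : W -> W') :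
    tensor V W -> tensor V' W' :=
  tlift (fun v w => f v ⊗ g w).

Definition tassoc (U V W : lmodType K) :
    tensor (tensor U V) W -> tensor U (tensor V W) :=
  tlift (fun x w => tlift (fun u v => u ⊗ (v ⊗ w)) x).

Lemma tlift_eq (V W U : lmodType K) (f g : V -> W -> U) :
  (forall v w, f v w = g v w) -> tlift f =1 tlift g.
Proof. by move=> fg x; apply: eq_bigr => p _; exact: fg. Qed.

Lemma tlift_combl (V W U : lmodType K) (f g : V -> W -> U) a x :
  tlift (fun v w => a *: f v w + g v w) x = a *: tlift f x + tlift g x.
Proof. by rewrite /tlift big_split /= -scaler_sumr. Qed.

Section TmapTheory.
Variables (V V' W W' : lmodType K) (f : V -> V') (g : W -> W').
Hypotheses (fl : linear f) (gl : linear g).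

Lemma tmap_bilinear : bilinear_for *:%R *:%R (fun v w => f v ⊗ g w).
Proof.
split=> [w|v] a x y /=; first by rewrite fl linearPl.
by rewrite gl linearPr.
Qed.

Lemma tmap_pure v w : tmap f g (v ⊗ w) = f v ⊗ g w.
Proof. exact: tlift_pure tmap_bilinear _ _. Qed.

Lemma tmap_linear : linear (tmap f g).
Proof. exact: tlift_linear tmap_bilinear. Qed.

End TmapTheory.

Section TassocTheory.
Variables (U V W : lmodType K).

Lemma tassoc_bilinear1 (w : W) :
  bilinear_for *:%R *:%R (fun (u : U) (v : V) => u ⊗ (v ⊗ w)).
Proof.
split=> [v|u] a x y /=; first by rewrite linearPl.
by rewrite linearPl linearPr.
Qed.

Lemma tassoc_bilinear :
  bilinear_for *:%R *:%R
    (fun (x : tensor U V) (w : W) => tlift (fun u v => u ⊗ (v ⊗ w)) x).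
Proof.
split=> [w|x] a y z /=; first by rewrite (tlift_linear (tassoc_bilinear1 w)).
rewrite -tlift_combl; apply: tlift_eq => u v.
by rewrite !linearPr.
Qed.

Lemma tassoc_pure (u : U) (v : V) (w : W) :
  tassoc ((u ⊗ v) ⊗ w) = u ⊗ (v ⊗ w).
Proof.
by rewrite /tassoc (tlift_pure tassoc_bilinear) (tlift_pure (tassoc_bilinear1 w)).
Qed.

Lemma tassoc_linear : linear (@tassoc U V W).
Proof. exact: tlift_linear tassoc_bilinear. Qed.

End TassocTheory.
End TensorMap.

(** The algebra structure on the tensor product of two algebras:
    [(a ⊗ b) * (c ⊗ d) = (a * c) ⊗ (b * d)].  It is registered as a
    [pzRingType] only: an [algType] requires [1 != 0]; see
    [scale_mul_tensorl] and [scale_mul_tensorr] for scalars. *)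
Section TensorRing.
Variables (K : fieldType) (A B : algType K).
Local Notation AB := (tensor A B).

Definition tmul (x y : AB) : AB :=
  tlift (fun a b => tlift (fun c d => (a * c) ⊗ (b * d)) y) x.

Lemma tmul_bilinear2 (a : A) (b : B) :
  bilinear_for *:%R *:%R (fun c d => (a * c) ⊗ (b * d)).
Proof.
split=> [d|c] k x y /=; first by rewrite mulrDr -scalerAr linearPl.
by rewrite mulrDr -scalerAr linearPr.
Qed.

Lemma tmul_bilinear1 (y : AB) :
  bilinear_for *:%R *:%R
    (fun a b => tlift (fun c d => (a * c) ⊗ (b * d)) y).
Proof.
split=> [b|a] k x z /=; rewrite -tlift_combl; apply: tlift_eq => c d.
  by rewrite mulrDl -scalerAl linearPl.
by rewrite mulrDl -scalerAl linearPr.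
Qed.

Lemma tmul_pure a b c d : tmul (a ⊗ b) (c ⊗ d) = (a * c) ⊗ (b * d).
Proof.
by rewrite /tmul (tlift_pure (tmul_bilinear1 _)) (tlift_pure (tmul_bilinear2 _ _)).
Qed.

Lemma tmul_linearl y : linear (tmul^~ y).
Proof. exact: tlift_linear (tmul_bilinear1 y). Qed.

Lemma tmul_linearr x : linear (tmul x).
Proof.
move=> k y z; rewrite /tmul -tlift_combl; apply: tlift_eq => a b.
exact: tlift_linear (tmul_bilinear2 a b) _ _ _.
Qed.

Lemma tmulDl : left_distributive tmul +%R.
Proof. by move=> x y z; have := tmul_linearl z 1 x y; rewrite /= !scale1r. Qed.

Lemma tmulDr : right_distributive tmul +%R.
Proof. by move=> x y z; have := tmul_linearr x 1 y z; rewrite !scale1r. Qed.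

Lemma tmul0 x : tmul x 0 = 0.
Proof. by apply: (addrI (tmul x 0)); rewrite -tmulDr !addr0. Qed.

Lemma t0mul x : tmul 0 x = 0.
Proof. by apply: (addrI (tmul 0 x)); rewrite -tmulDl !addr0. Qed.

Lemma tmulA : associative tmul.
Proof.
move=> x y z; elim/tensor_ind: x => [|x a b IHx]; first by rewrite !t0mul.
rewrite !tmulDl IHx; congr (_ + _) => {x IHx}.
elim/tensor_ind: y => [|y c d IHy]; first by rewrite !(t0mul, tmul0).
rewrite tmulDl !tmulDr tmulDl IHy; congr (_ + _) => {y IHy}.
elim/tensor_ind: z => [|z e f IHz]; first by rewrite !tmul0.
by rewrite !tmulDr IHz !tmul_pure !mulrA.
Qed.

Lemma tmul1l : left_id (1 ⊗ 1) tmul.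
Proof.
elim/tensor_ind => [|x a b IHx]; first by rewrite tmul0.
by rewrite tmulDr IHx tmul_pure !mul1r.
Qed.

Lemma tmul1r : right_id (1 ⊗ 1) tmul.
Proof.
elim/tensor_ind => [|x a b IHx]; first by rewrite t0mul.
by rewrite tmulDl IHx tmul_pure !mulr1.
Qed.

HB.instance Definition _ := GRing.Zmodule_isPzRing.Build AB
  tmulA tmul1l tmul1r tmulDl tmulDr.

Lemma mul_pure (a c : A) (b d : B) : (a ⊗ b) * (c ⊗ d) = (a * c) ⊗ (b * d).
Proof. exact: tmul_pure. Qed.

Lemma one_pure : 1 = 1 ⊗ 1 :> AB.
Proof. by []. Qed.

Lemma scale_mul_tensorl (k : K) (x y : AB) : k *: (x * y) = (k *: x) * y.
Proof.
have := tmul_linearl y k x 0; rewrite /= t0mul !addr0 => E.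
exact: esym E.
Qed.

Lemma scale_mul_tensorr (k : K) (x y : AB) : k *: (x * y) = x * (k *: y).
Proof.
have := tmul_linearr x k y 0; rewrite /= tmul0 !addr0 => E.
exact: esym E.
Qed.

End TensorRing.

(** * Bialgebras

    The requirement [1 != 0] built into [algType] is no restriction here, since
    [counit 1 = 1] in a field. *)

HB.mixin Record isCoalgebra (K : fieldType) C of GRing.Lmodule K C := {
  comul : {linear C -> tensor C C};
  counit : {scalar C};
  comulA : forall x : C,
    tassoc (tmap comul idfun (comul x)) = tmap idfun comul (comul x);
  (* the counit laws are stated through the identifications of
     K ⊗ C and C ⊗ K with C *)
  counitl : forall x : C, tlift (fun a b => counit a *: b) (comul x) = x;
  counitr : forall x : C, tlift (fun a b => counit b *: a) (comul x) = x
}.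

#[short(type="coalgType")]
HB.structure Definition Coalgebra (K : fieldType) :=
  { C of isCoalgebra K C & GRing.Lmodule K C }.

HB.mixin Record isBialgebra (K : fieldType) B
    of GRing.Algebra K B & Coalgebra K B := {
  comul_monoid_morphism : monoid_morphism (comul : B -> tensor B B);
  counit_monoid_morphism : monoid_morphism (counit : B -> K)
}.

#[short(type="bialgType")]
HB.structure Definition Bialgebra (K : fieldType) :=
  { B of isBialgebra K B & GRing.Algebra K B & Coalgebra K B }.

Definition coalg_morphism (K : fieldType) (C D : coalgType K) (f : C -> D) :=
  (forall x, tmap f f (comul x) = comul (f x)) /\
  (forall x, counit (f x) = counit x).

Definition bialg_morphism (K : fieldType) (A B : bialgType K) (f : A -> B) :=
  [/\ linear f, monoid_morphism f & coalg_morphism f].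

Record bialg_hom (K : fieldType) (A B : bialgType K) := BialgHom {
  bialg_fun :> A -> B;
  bialg_funP : bialg_morphism bialg_fun
}.

Section BialgHom.
Variable K : fieldType.
Implicit Types A B C : bialgType K.

Lemma bialg_hom_ext A B (f g : bialg_hom A B) : f =1 g -> f = g.
Proof.
case: f g => [f fP] [g gP] /= /funext fg; rewrite {}fg in fP *.
by rewrite (Prop_irrelevance fP gP).
Qed.

Lemma id_bialg_morphism A : bialg_morphism (@idfun A).
Proof.
split=> //; split=> // x; move: {x}(comul x).
by apply: tensor_ext => [||a b]; rewrite ?tmap_pure //; exact: tmap_linear.
Qed.

Definition bialg_id A : bialg_hom A A := BialgHom (id_bialg_morphism A).

Lemma comp_bialg_morphism A B C (g : bialg_hom B C) (f : bialg_hom A B) :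
  bialg_morphism (g \o f).
Proof.
case: f g => [f [fl fm [fD fe]]] [g [gl gm [gD ge]]] /=.
have gfl : linear (g \o f) by move=> a x y; rewrite /= fl gl.
split=> //.
- by split=> [|x y]; rewrite /= !(fm, gm).
- split=> x /=; last by rewrite ge fe.
  rewrite -gD -fD; move: {x}(comul x).
  apply: tensor_ext => [||a b]; first exact: tmap_linear.
    by move=> a x y; rewrite (tmap_linear fl) // (tmap_linear gl).
  by rewrite !tmap_pure.
Qed.

Definition bialg_comp A B C (g : bialg_hom B C) (f : bialg_hom A B) :
  bialg_hom A C := BialgHom (comp_bialg_morphism g f).

End BialgHom.

(** The base field as a bialgebra over itself. *)
Section BaseField.
Variable K : fieldType.

Definition base_comul (a : K^o) : tensor K^o K^o := a ⊗ 1.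

Lemma base_comul_linear : linear base_comul.
Proof. by move=> a x y; rewrite /base_comul linearPl. Qed.

HB.instance Definition _ :=
  GRing.isLinear.Build K K^o (tensor K^o K^o) *:%R base_comul base_comul_linear.

Definition base_counit (a : K^o) : K := a.

Lemma base_counit_scalar : scalar base_counit.
Proof. by []. Qed.

HB.instance Definition _ :=
  GRing.isLinear.Build K K^o K *%R base_counit base_counit_scalar.

Lemma base_comulA (x : K^o) :
  tassoc (tmap base_comul idfun (base_comul x)) =
  tmap idfun base_comul (base_comul x).
Proof.
by rewrite !tmap_pure ?tassoc_pure //; exact: base_comul_linear.
Qed.

Lemma base_counitl (x : K^o) :
  tlift (fun a b => base_counit a *: b) (base_comul x) = x.
Proof.
rewrite tlift_pure ?[_ *: _]mulr1 //; split=> [b|a] k y z /=.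
  by rewrite scalerDl scalerA.
by rewrite scalerDr !scalerA mulrC.
Qed.

Lemma base_counitr (x : K^o) :
  tlift (fun a b => base_counit b *: a) (base_comul x) = x.
Proof.
rewrite tlift_pure ?[_ *: _]mul1r //; split=> [b|a] k y z /=.
  by rewrite scalerDr !scalerA mulrC.
by rewrite scalerDl scalerA.
Qed.

HB.instance Definition _ := isCoalgebra.Build K K^o
  base_comulA base_counitl base_counitr.

Lemma base_comul_monoid_morphism :
  monoid_morphism (comul : K^o -> tensor K^o K^o).
Proof.
by split=> // x y; rewrite /comul /= /base_comul mul_pure mulr1.
Qed.

Lemma base_counit_monoid_morphism : monoid_morphism (counit : K^o -> K).
Proof. by []. Qed.

HB.instance Definition _ := isBialgebra.Build K K^o
  base_comul_monoid_morphism base_counit_monoid_morphism.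

Definition base_bialg : bialgType K := K^o.

Lemma bialg_unit_morphism (A : bialgType K) :
  bialg_morphism (fun a : K^o => (a : K)%:A : A).
Proof.
have lin : linear (fun a : K^o => (a : K)%:A : A).
  by move=> a x y; rewrite scalerDl scalerA.
split=> //.
- by split=> [|x y] /=; rewrite ?scale1r // -scalerAl -scalerAr mul1r scalerA.
- split=> x.
    rewrite [comul x]/(x ⊗ 1) tmap_pure // scale1r linearZ /=.
    by rewrite (comul_monoid_morphism (s := A)).1 one_pure linearZl.
  rewrite linearZ /= (counit_monoid_morphism (s := A)).1; exact: mulr1.
Qed.

Definition bialg_unit (A : bialgType K) : bialg_hom base_bialg A :=
  BialgHom (bialg_unit_morphism A).

Lemma bialg_counit_morphism (A : bialgType K) :
  bialg_morphism (fun x : A => counit x : K^o).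
Proof.
split.
- by move=> a x y; rewrite linearP.
- exact: counit_monoid_morphism.
- split=> // x.
  have lin : linear (fun x : A => counit x : K^o) by move=> a y z; rewrite linearP.
  have rhsE : comul (counit x : K^o) = (counit x : K^o) ⊗ (1 : K^o) by [].
  rewrite rhsE -[in RHS](counitl x); move: {x rhsE}(comul x).
  have cbil : bilinear_for *:%R *:%R (fun a b : A => counit a *: b).
    split=> [b|a] k y z /=.
      by rewrite linearP scalerDl scalerA.
    by rewrite scalerDr !scalerA mulrC.
  apply: tensor_ext => [||a b]; first exact: tmap_linear.
    by move=> k y z; rewrite (tlift_linear cbil) linearP linearPl.
  rewrite tmap_pure // (tlift_pure cbil) linearZ /=.
  have bil := pure_bilinear K^o K^o.
  have := bilZr bil (counit b) (counit a) 1.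
  rewrite -(bilZl bil) => E.
  rewrite mulrC -[X in _ ⊗ X]mulr1; exact: E.
Qed.

Definition bialg_counit (A : bialgType K) : bialg_hom A base_bialg :=
  BialgHom (bialg_counit_morphism A).

Lemma bialg_unit_uniq (A : bialgType K) (f : bialg_hom base_bialg A) :
  f = bialg_unit A.
Proof.
apply: bialg_hom_ext => x; case: f => f [fl [f1 _] _] /=.
have f0 : f 0 = 0.
  by have := fl 1 0 0; rewrite !scale1r addr0 -[LHS]addr0 => /addrI.
have := fl x 1 0; rewrite f0 !addr0 -[x *: 1]/(x * 1) mulr1 f1 => E.
exact: E.
Qed.

Lemma bialg_counit_uniq (A : bialgType K) (f : bialg_hom A base_bialg) :
  f = bialg_counit A.
Proof.
by apply: bialg_hom_ext => x; case: f => f [fl fm [_ fe]] /=; rewrite -fe.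
Qed.

End BaseField.

(** * Split extensions and protomodular objects *)

Record category := Category {
  ob :> Type;
  hom : ob -> ob -> Type;
  idm : forall X, hom X X;
  compm : forall X Y Z, hom Y Z -> hom X Y -> hom X Z;
  comp_id_l : forall X Y (f : hom X Y), compm (idm Y) f = f;
  comp_id_r : forall X Y (f : hom X Y), compm f (idm X) = f;
  comp_assoc : forall X Y Z T (h : hom Z T) (g : hom Y Z) (f : hom X Y),
    compm h (compm g f) = compm (compm h g) f
}.

Arguments hom {c} X Y.
Arguments idm {c} X.
Arguments compm {c X Y Z} g f.

Notation "g ∘ f" := (compm g f) (at level 40, left associativity).

Record pointedCategory := PointedCategory {
  pointed_cat :> category;
  zero_obj : pointed_cat;
  from_zero : forall X : pointed_cat, hom zero_obj X;
  to_zero : forall X : pointed_cat, hom X zero_obj;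
  from_zero_uniq : forall (X : pointed_cat) (f : hom zero_obj X), f = from_zero X;
  to_zero_uniq : forall (X : pointed_cat) (f : hom X zero_obj), f = to_zero X
}.

Arguments zero_obj {p}.
Arguments from_zero {p} X.
Arguments to_zero {p} X.

Section Categorical.
Variable C : pointedCategory.
Implicit Types X Y Z K M P W : C.

Definition zero_mor X Y : hom X Y := from_zero Y ∘ to_zero X.

Definition mono X Y (m : hom X Y) :=
  forall Z (u v : hom Z X), m ∘ u = m ∘ v -> u = v.

Definition iso X Y (f : hom X Y) :=
  exists g : hom Y X, g ∘ f = idm X /\ f ∘ g = idm Y.

Definition is_kernel K X Y (k : hom K X) (f : hom X Y) :=
  f ∘ k = zero_mor K Y /\
  forall Z (h : hom Z X), f ∘ h = zero_mor Z Y -> exists! u : hom Z K, k ∘ u = h.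

Definition is_pullback P W X Y
    (p1 : hom P W) (p2 : hom P X) (g : hom W Y) (f : hom X Y) :=
  g ∘ p1 = f ∘ p2 /\
  forall Z (a : hom Z W) (b : hom Z X), g ∘ a = f ∘ b ->
    exists! u : hom Z P, p1 ∘ u = a /\ p2 ∘ u = b.

Definition factors_through Z M X (h : hom Z X) (m : hom M X) :=
  exists u : hom Z M, m ∘ u = h.

Definition jointly_extremally_epic K Y X (k : hom K X) (s : hom Y X) :=
  forall M (m : hom M X), mono m ->
    factors_through k m -> factors_through s m -> iso m.

Record split_extension Y := SplitExtension {
  se_ker : C;
  se_mid : C;
  se_k : hom se_ker se_mid;
  se_f : hom se_mid Y;
  se_s : hom Y se_mid;
  se_kernel : is_kernel se_k se_f;
  se_split : se_f ∘ se_s = idm Y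
}.

Definition strong Y (E : split_extension Y) :=
  jointly_extremally_epic (se_k E) (se_s E).

(** [E'] is a pullback of [E] along [g].  As [p2] is the second projection,
    [p2 ∘ se_s E' = se_s E ∘ g] together with [se_split E'] says that the
    section of [E'] is <1, se_s E ∘ g>. *)
Definition is_pullback_extension Y W (g : hom W Y)
    (E : split_extension Y) (E' : split_extension W) :=
  exists p2 : hom (se_mid E') (se_mid E),
    is_pullback (se_f E') p2 g (se_f E) /\ p2 ∘ se_s E' = se_s E ∘ g.

(** Pullbacks and kernels are given by their universal properties, so [E']
    ranges over all representatives of the pullback of [E] along [g]. *)
Definition stably_strong Y (E : split_extension Y) :=
  forall W (g : hom W Y) (E' : split_extension W),
    is_pullback_extension g E E' -> strong E'.

Definition protomodular_object Y :=
  forall E : split_extension Y, stably_strong E.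

End Categorical.

(** * The pointed category of bialgebras *)

Section BiAlg.
Variable K : fieldType.

Lemma bialg_comp_id_l (A B : bialgType K) (f : bialg_hom A B) :
  bialg_comp (bialg_id B) f = f.
Proof. exact: bialg_hom_ext. Qed.

Lemma bialg_comp_id_r (A B : bialgType K) (f : bialg_hom A B) :
  bialg_comp f (bialg_id A) = f.
Proof. exact: bialg_hom_ext. Qed.

Lemma bialg_comp_assoc (A B C D : bialgType K)
    (h : bialg_hom C D) (g : bialg_hom B C) (f : bialg_hom A B) :
  bialg_comp h (bialg_comp g f) = bialg_comp (bialg_comp h g) f.
Proof. exact: bialg_hom_ext. Qed.

Definition BiAlgCat : category :=
  Category bialg_comp_id_l bialg_comp_id_r bialg_comp_assoc.

Definition BiAlg : pointedCategory :=
  @PointedCategory BiAlgCat (base_bialg K) (@bialg_unit K) (@bialg_counit K)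
    (@bialg_unit_uniq K) (@bialg_counit_uniq K).

End BiAlg.

(* Main.v *)
From HB Require Import structures.
From mathcomp Require Import all_boot all_algebra.
From mathcomp Require Import boolp functions.
Require Import Defs.

Set Implicit Arguments.
Unset Strict Implicit.
Unset Printing Implicit Defensive.

Import GRing.Theory.
Local Open Scope ring_scope.

(** The base field is the zero object, and every object [X] is the middle of a
    split extension over it, with kernel the identity of [X].  Pulling this
    extension back along [W -> 0] gives the product [W × X] with its two
    canonical inclusions of [X] and [W]; so if the zero object were
    protomodular, these inclusions would be jointly extremally epic for all [W]
    and [X] that have a product ([protomodular_zero_product]).  This fails
    because both inclusions factor through a copy of the tensor product [W ⊗ X]
    inside [W × X], whereas the product of bialgebras that need not be
    cocommutative is in general much larger: dually, it is a free product of
    algebras rather than a tensor product.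

    Products of bialgebras are hard to describe in general, so [W] and [X] are
    chosen for their product to be explicit.  For a monoid [N], let [R(N)] be
    the bialgebra of representative functions on [N]: pointwise product, and
    comultiplication dual to that of [N].  A bialgebra morphism [B -> R(N)] is
    the same as a monoid morphism from [N] to the algebra characters of [B]
    under convolution ([hom_character_family], [induced_hom]).  Hence [R] turns
    coproducts of monoids into products of bialgebras, and in particular, with
    [F] the free monoid functor, [R(F(T1 + T2))] is the product of [R(F(T1))]
    and [R(F(T2))] ([repr_product]).

    The surjection of monoids [F(T1 + T2) -> F(T1) × F(T2)] induces an
    injective morphism [R(F(T1) × F(T2)) -> R(F(T1 + T2))], through which both
    inclusions factor.  Its image consists of functions that do not see the
    relative order of letters from [T1] and letters from [T2].  The
    function that tests whether a word starts with a letter from [T1] is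
    representative and does see this order ([inflate_parts_not_surj]), so this monomorphism is not invertible. *)

(** * Linear functionals on tensor products *)

Section TensorSeparation.
Variables (K : fieldType) (V W : lmodType K) (I : Type) (phi : I -> V -> K).
Hypothesis phi_scalar : forall i, scalar (phi i).
Hypothesis phi_sep : forall v, (forall i, phi i v = 0) -> v = 0.

Lemma separating_bilinear i :
  bilinear_for *:%R *:%R (fun v (w : W) => phi i v *: w).
Proof.
split=> [w|v] a x y /=; first by rewrite phi_scalar scalerDl scalerA.
by rewrite scalerDr !scalerA mulrC.
Qed.

(** Only finitely many pure tensors occur in [x], so one may induct on their
    number: if some [phi i0] does not vanish on the first left factor, the
    hypothesis at [i0] expresses the first right factor through the others, and
    the first pure tensor can be absorbed into them. *)
Lemma tensor_separated (x : tensor V W) :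
  (forall i, tlift (fun v w => phi i v *: w) x = 0) -> x = 0.
Proof.
rewrite {2}(tensorE x) /tlift.
have [n] := ubnP (size (trepr x)); elim: n (trepr x) => // n IHn [|[v w] s] /=.
  by rewrite big_nil.
rewrite ltnS => s_lt_n s0.
have [v0|/existsNP[i0 /eqP c_neq0]] := pselect (forall i, phi i v = 0).
  rewrite big_cons /= (phi_sep v0) linear0l add0r.
  by apply: IHn => // i; have := s0 i; rewrite big_cons /= v0 scale0r add0r.
set c := phi i0 v in c_neq0.
have wE : w = - (c^-1 *: \sum_(p <- s) phi i0 p.1 *: p.2).
  have := s0 i0; rewrite big_cons /= -/c => /eqP; rewrite addr_eq0 => /eqP cw.
  by rewrite -scalerN -cw scalerA mulVf ?scale1r.
(* Substituting wE for w in (v, w) and collecting terms by right factor. *)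
pose s' := [seq (p.1 - (phi i0 p.1 / c) *: v, p.2) | p <- s].
have sumE (U : lmodType K) (f : V -> W -> U) : bilinear_for *:%R *:%R f ->
    \sum_(p <- s') f p.1 p.2 = \sum_(p <- (v, w) :: s) f p.1 p.2.
  move=> fbil; rewrite big_map big_cons /= addrC.
  have -> : f v w = \sum_(p <- s) - ((phi i0 p.1 / c) *: f v p.2).
    rewrite wE -scaleN1r !(bilZr fbil) scaleN1r sumrN; congr (- _).
    have fs : f v (\sum_(p <- s) phi i0 p.1 *: p.2) =
        \sum_(p <- s) phi i0 p.1 *: f v p.2.
      elim: s {s0 s_lt_n IHn wE s'} => [|p s IHs].
        by rewrite !big_nil (bil0r fbil).
      by rewrite !big_cons (bilDr fbil) (bilZr fbil) IHs.
    rewrite fs scaler_sumr; apply: eq_bigr => p _.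
    by rewrite scalerA mulrC.
  rewrite -big_split; apply: eq_bigr => p _ /=.
  by rewrite (bilDl fbil) -scaleN1r !(bilZl fbil) scaleN1r.
rewrite -(sumE _ _ (pure_bilinear _ _)); apply: IHn => [|i].
  by rewrite size_map.
by rewrite (sumE _ _ (separating_bilinear i)) s0.
Qed.

Lemma tensor_separated_eq (x y : tensor V W) :
  (forall i, tlift (fun v w => phi i v *: w) x =
             tlift (fun v w => phi i v *: w) y) -> x = y.
Proof.
move=> xy; apply/eqP; rewrite -subr_eq0; apply/eqP.
apply: tensor_separated => i.
rewrite -scaleN1r addrC (tlift_linear (separating_bilinear i)) xy.
by rewrite scaleN1r addNr.
Qed.

End TensorSeparation.

Section Pairing.
Variable K : fieldType.

Section Scalar.
Variables (V : lmodType K) (a : V -> K).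
Hypothesis al : scalar a.

Lemma scalar_at0 : a 0 = 0.
Proof.
by have := al 1 0 0; rewrite scale1r mul1r addr0 -[LHS]addr0 => /addrI.
Qed.

Lemma scalar_atZ k x : a (k *: x) = k * a x.
Proof. by have := al k x 0; rewrite scalar_at0 !addr0. Qed.

Lemma scalar_atD x y : a (x + y) = a x + a y.
Proof. by have := al 1 x y; rewrite scale1r mul1r. Qed.

End Scalar.

(** This is [a ⊗ b] followed by the identification of [K ⊗ K] with [K]. *)
Definition tpair (V W : lmodType K) (a : V -> K) (b : W -> K) :
    tensor V W -> K :=
  tlift (U := K^o) (fun v w => a v * b w).

Section Theory.
Variables (V W : lmodType K) (a : V -> K) (b : W -> K).
Hypotheses (al : scalar a) (bl : scalar b).

Lemma tpair_bilinear :
  bilinear_for *:%R *:%R (fun v w => a v * b w : K^o).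
Proof.
split=> [w|v] k x y /=; first by rewrite al mulrDl -mulrA.
by rewrite bl mulrDr mulrCA.
Qed.

Lemma tpair_pure v w : tpair a b (v ⊗ w) = a v * b w.
Proof. exact: tlift_pure tpair_bilinear _ _. Qed.

Lemma tpair_scalar : scalar (tpair a b).
Proof. exact: tlift_linear tpair_bilinear. Qed.

End Theory.

Lemma tpair_ext (V W : lmodType K) (g h : tensor V W -> K) :
  scalar g -> scalar h -> (forall v w, g (v ⊗ w) = h (v ⊗ w)) -> g =1 h.
Proof. by move=> gl hl; apply: (tensor_ext (U := K^o)). Qed.

Lemma eq_tpair (V W : lmodType K) (a a' : V -> K) (b b' : W -> K) :
  a =1 a' -> b =1 b' -> tpair a b =1 tpair a' b'.
Proof. by move=> aa bb; apply: (tlift_eq (U := K^o)) => v w; rewrite aa bb. Qed.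

Lemma tpair_tmap (V V' W W' : lmodType K) (f : V -> V') (g : W -> W')
    (a : V' -> K) (b : W' -> K) :
  linear f -> linear g -> scalar a -> scalar b ->
  forall x, tpair a b (tmap f g x) = tpair (a \o f) (b \o g) x.
Proof.
move=> fl gl al bl.
have afl : scalar (a \o f) by move=> k x y; rewrite /= fl al.
have bgl : scalar (b \o g) by move=> k x y; rewrite /= gl bl.
apply: tpair_ext => [k x y||v w]; last by rewrite tmap_pure // !tpair_pure.
- by rewrite (tmap_linear fl gl) tpair_scalar.
- exact: tpair_scalar.
Qed.

Lemma tpair_tassoc (U V W : lmodType K) (a : U -> K) (b : V -> K) (c : W -> K) :
  scalar a -> scalar b -> scalar c ->
  forall x, tpair a (tpair b c) (tassoc x) = tpair (tpair a b) c x.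
Proof.
move=> al bl cl; have abl := tpair_scalar al bl; have bcl := tpair_scalar bl cl.
have asl : scalar (tpair a (tpair b c) \o @tassoc K U V W).
  by move=> k x y; rewrite /= tassoc_linear tpair_scalar.
apply: (tpair_ext asl) => [|x w]; first exact: tpair_scalar.
rewrite tpair_pure //=; move: x.
apply: (@tpair_ext U V (fun x => tpair a (tpair b c) (tassoc (x ⊗ w)))
  (fun x => tpair a b x * c w)) => [k x y|k x y|u v] /=.
- by rewrite linearPl; exact: asl.
- by rewrite abl mulrDl mulrA.
- by rewrite tassoc_pure !tpair_pure // mulrA.
Qed.

Lemma tpairM (A B : algType K) (a : A -> K) (b : B -> K) :
  scalar a -> scalar b -> {morph a : x y / x * y} -> {morph b : x y / x * y} ->
  {morph tpair a b : x y / x * y}.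
Proof.
move=> al bl aM bM x y; move: x.
apply: (@tpair_ext A B (fun x => tpair a b (x * y))
  (fun x => tpair a b x * tpair a b y)) => [k u v|k u v|u v] /=.
- by rewrite mulrDl -scale_mul_tensorl tpair_scalar.
- by rewrite tpair_scalar // mulrDl mulrA.
move: y.
apply: (@tpair_ext A B (fun y => tpair a b ((u ⊗ v) * y))
  (fun y => tpair a b (u ⊗ v) * tpair a b y)) => [k x y|k x y|x y] /=.
- by rewrite mulrDr -scale_mul_tensorr tpair_scalar.
- by rewrite tpair_scalar // mulrDr mulrCA.
- by rewrite mul_pure !tpair_pure // aM bM mulrACA.
Qed.

End Pairing.

(** * Convolution of functionals *)

Section Convolution.
Variables (K : fieldType) (B : bialgType K).
Implicit Types a b c : B -> K.

Definition conv a b : B -> K := fun x => tpair a b (comul x).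

Lemma eq_conv a a' b b' : a =1 a' -> b =1 b' -> conv a b =1 conv a' b'.
Proof. by move=> aa bb x; exact: eq_tpair. Qed.

Lemma conv_scalar a b : scalar a -> scalar b -> scalar (conv a b).
Proof. by move=> al bl k x y; rewrite /conv linearP tpair_scalar. Qed.

Lemma counit_scalar : scalar (counit : B -> K).
Proof. by move=> k x y; rewrite linearP. Qed.

Lemma conv1l b : scalar b -> conv counit b =1 b.
Proof.
move=> bl x; rewrite -{2}(counitl x) /conv; move: {x}(comul x).
have bil : bilinear_for *:%R *:%R (fun x y : B => counit x *: y).
  exact: (@separating_bilinear _ _ _ unit (fun=> counit)
    (fun=> counit_scalar) tt).
apply: tpair_ext => [|k x y|x y]; first exact: tpair_scalar counit_scalar bl.
  by rewrite (tlift_linear bil) bl.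
by rewrite (tpair_pure counit_scalar bl) (tlift_pure bil) (scalar_atZ bl).
Qed.

Lemma conv1r a : scalar a -> conv a counit =1 a.
Proof.
move=> al x; rewrite -{2}(counitr x) /conv; move: {x}(comul x).
have bil : bilinear_for *:%R *:%R (fun x y : B => counit y *: x).
  by split=> [y|x] k z t /=;
    rewrite ?(counit_scalar, scalerDl, scalerDr, scalerA) // mulrC.
apply: tpair_ext => [|k x y|x y]; first exact: tpair_scalar al counit_scalar.
  by rewrite (tlift_linear bil) al.
by rewrite (tpair_pure al counit_scalar) (tlift_pure bil) mulrC (scalar_atZ al).
Qed.

Lemma convA a b c : scalar a -> scalar b -> scalar c ->
  conv a (conv b c) =1 conv (conv a b) c.
Proof.
move=> al bl cl x; rewrite {1}/conv {2}/conv.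
have comul_linear : linear (comul : B -> tensor B B).
  by move=> k y z; rewrite linearP.
have bcl := tpair_scalar bl cl; have abl := tpair_scalar al bl.
have -> : tpair a (conv b c) (comul x) =
    tpair a (tpair b c) (tmap idfun comul (comul x)).
  by rewrite tpair_tmap.
by rewrite -comulA tpair_tassoc // tpair_tmap.
Qed.

Lemma conv_monoid_morphism a b : scalar a -> scalar b ->
  GRing.monoid_morphism a -> GRing.monoid_morphism b ->
  GRing.monoid_morphism (conv a b).
Proof.
move=> al bl [a1 aM] [b1 bM]; have [c1 cM] := comul_monoid_morphism (s := B).
split=> [|x y]; rewrite /conv; first by rewrite c1 tpair_pure // a1 b1 mulr1.
by rewrite cM (tpairM al bl aM bM).
Qed.

End Convolution.

(** * The bialgebra of representative functions on a monoid *)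

Section Representative.
Variables (K : fieldType) (N : monoidType).
Implicit Types (S : (N -> K) -> Prop) (f g : N -> K).

Definition splits_in S f : Prop := exists (I : finType) (p q : I -> N -> K),
  (forall i, S (p i) /\ S (q i)) /\
  (forall u v, f (u * v)%g = \sum_i p i u * q i v).

(** Membership in the largest subcoalgebra of functions on [N].  This is
    equivalent to the usual condition that the translates of [f] span a
    finite-dimensional space, but being coinductive it provides at once the
    splitting of [f] into functions that are themselves representative, which
    the comultiplication requires. *)
Definition representative f : Prop :=
  exists2 S, (forall g, S g -> splits_in S g) & S f.

Lemma splits_in_sub S S' f :
  (forall g, S g -> S' g) -> splits_in S f -> splits_in S' f.
Proof.
move=> SS' [I [p [q [pqS pqE]]]]; exists I, p, q; split=> // i.
by have [? ?] := pqS i; split; exact: SS'.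
Qed.

Lemma representative_splits f :
  representative f -> splits_in representative f.
Proof.
by case=> S Scl /Scl; apply: splits_in_sub => g Sg; exists S.
Qed.

(** Coinduction up to representative functions: the pieces of a splitting may
    leave [S] if they are already known to be representative. *)
Lemma representative_coind S :
  (forall g, S g -> splits_in (fun h => S h \/ representative h) g) ->
  forall f, S f -> representative f.
Proof.
move=> Scl f Sf; exists (fun h => S h \/ representative h); last by left.
move=> g [/Scl //|/representative_splits].
by apply: splits_in_sub => h; right.
Qed.

Lemma representative1 : representative (fun=> 1).
Proof.
exists (fun f => f = fun=> 1) => // _ ->.
exists unit, (fun _ _ => 1), (fun _ _ => 1); split=> // u v.
by rewrite (big_pred1 tt) ?mulr1 //; case.
Qed.

Lemma representativeZ k f :
  representative f -> representative (fun u => k * f u).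
Proof.
move=> fR; pose S g := exists2 h, representative h & g = fun u => k * h u.
apply: (@representative_coind S); last by exists f.
move=> _ [h /representative_splits[I [p [q [pqR hE]]]] ->].
exists I, (fun i u => k * p i u), q; split=> [i|u v].
  by have [? ?] := pqR i; split; [left; exists (p i)|right].
by rewrite hE mulr_sumr; apply: eq_bigr => i _; rewrite mulrA.
Qed.

Lemma representativeD f g :
  representative f -> representative g -> representative (f + g).
Proof.
move=> fR gR; apply: (@representative_coind (fun h => h = f + g)) => // _ ->.
have [I [p [q [pqR fE]]]] := representative_splits fR.
have [J [r [s [rsR gE]]]] := representative_splits gR.
exists (I + J)%type, (fun x => match x with inl i => p i | inr j => r j end),
  (fun x => match x with inl i => q i | inr j => s j end).
split=> [[i|j]|u v].
- by have [? ?] := pqR i; split; right.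
- by have [? ?] := rsR j; split; right.
- by rewrite big_sumType /= -gE -fE.
Qed.

Lemma representativeN f : representative f -> representative (- f).
Proof.
suff -> : - f = fun u => -1 * f u by exact: representativeZ.
by apply/funext => u; rewrite mulN1r.
Qed.

Lemma representativeM f g :
  representative f -> representative g -> representative (f * g).
Proof.
move=> fR gR.
pose S h := exists f' g',
  [/\ representative f', representative g' & h = f' * g'].
apply: (@representative_coind S); last by exists f, g.
move=> _ [f' [g' [/representative_splits[I [p [q [pqR fE]]]]
  /representative_splits[J [r [s [rsR gE]]]] ->]]].
exists (I * J)%type, (fun i => p i.1 * r i.2), (fun i => q i.1 * s i.2).
split=> [[i j]|u v] /=.
  by have [? ?] := pqR i; have [? ?] := rsR j;
    split; left; [exists (p i), (r j)|exists (q i), (s j)].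
transitivity (f' (u * v)%g * g' (u * v)%g) => //.
rewrite fE gE mulr_suml.
rewrite -(pair_bigA _ (fun i j => p i u * r j u * (q i v * s j v))).
apply: eq_bigr => i _; rewrite mulr_sumr.
by apply: eq_bigr => j _; exact: mulrACA.
Qed.

Definition representativeb : {pred N -> K} := fun f => `[< representative f >].

Record repr_fun := ReprFun {
  repr_val :> N -> K;
  _ : repr_val \in representativeb
}.

HB.instance Definition _ := [isSub for repr_val].
HB.instance Definition _ := [Choice of repr_fun by <:].

Lemma representativebP f : reflect (representative f) (f \in representativeb).
Proof. exact: asboolP. Qed.

Lemma repr_funP (f : repr_fun) : representative f.
Proof. by case: f => f fR; exact/representativebP. Qed.

Definition to_repr f (fR : representative f) : repr_fun :=
  ReprFun (introT (representativebP f) fR).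

Lemma repr_fun_ext (f g : repr_fun) : f =1 g -> f = g.
Proof. by move=> fg; apply/val_inj/funext. Qed.

Lemma representative_subring : GRing.subring_closed representativeb.
Proof.
split=> [|f g /representativebP fR /representativebP gR|
         f g /representativebP fR /representativebP gR]; apply/representativebP.
- exact: representative1.
- by apply: representativeD => //; exact: representativeN.
- exact: representativeM.
Qed.

HB.instance Definition _ :=
  GRing.SubChoice_isSubPzRing.Build _ _ repr_fun representative_subring.
Definition repr_scale k (f : repr_fun) : repr_fun :=
  to_repr (representativeZ k (repr_funP f)).

Lemma repr_scaleA a b (f : repr_fun) :
  repr_scale a (repr_scale b f) = repr_scale (a * b) f.
Proof. by apply: repr_fun_ext => u; exact: mulrA. Qed.

Lemma repr_scale1 : left_id 1 repr_scale.
Proof. by move=> f; apply: repr_fun_ext => u; exact: mul1r. Qed.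

Lemma repr_scaleDr : right_distributive repr_scale +%R.
Proof. by move=> a f g; apply: repr_fun_ext => u; exact: mulrDr. Qed.

Lemma repr_scaleDl (f : repr_fun) : {morph repr_scale^~ f : a b / a + b}.
Proof. by move=> a b; apply: repr_fun_ext => u; exact: mulrDl. Qed.

HB.instance Definition _ := GRing.Zmodule_isLmodule.Build K repr_fun
  repr_scaleA repr_scale1 repr_scaleDr repr_scaleDl.

Lemma repr_fun_oner_neq0 : 1 != 0 :> repr_fun.
Proof.
apply/eqP => /(congr1 (fun f : repr_fun => f 1%g)) /eqP.
by rewrite oner_eq0.
Qed.

HB.instance Definition _ :=
  GRing.PzSemiRing_isNonZero.Build repr_fun repr_fun_oner_neq0.

Lemma repr_fun_scaleAl k (f g : repr_fun) : k *: (f * g) = k *: f * g.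
Proof. by apply: repr_fun_ext => u; exact: mulrA. Qed.

Lemma repr_fun_scaleAr k (f g : repr_fun) : k *: (f * g) = f * (k *: g).
Proof. by apply: repr_fun_ext => u; exact: mulrCA. Qed.

HB.instance Definition _ :=
  GRing.Lmodule_isLalgebra.Build K repr_fun repr_fun_scaleAl.
HB.instance Definition _ :=
  GRing.LSemiAlgebra_isSemiAlgebra.Build K repr_fun repr_fun_scaleAr.

End Representative.

Section ReprCoalgebra.
Variables (K : fieldType) (N : monoidType).
Local Notation R := (repr_fun K N).
Implicit Types f g : R.

Definition ev (u : N) (f : R) : K := f u.

Lemma ev_scalar u : scalar (ev u).
Proof. by []. Qed.

Lemma ev_monoid_morphism u : GRing.monoid_morphism (ev u).
Proof. by []. Qed.

Lemma ev_separates f : (forall u, ev u f = 0) -> f = 0.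
Proof. by move=> f0; apply: repr_fun_ext. Qed.

Lemma ev_tensor (W : lmodType K) (b : W -> K) u (x : tensor R W) : scalar b ->
  b (tlift (fun f w => ev u f *: w) x) = tpair (ev u) b x.
Proof.
move=> bl; move: x.
have bil : bilinear_for *:%R *:%R (fun f (w : W) => ev u f *: w).
  exact: (separating_bilinear _ ev_scalar).
apply: tpair_ext => [k x y||f w]; last 1 first.
- by rewrite (tlift_pure bil) (tpair_pure (ev_scalar u) bl) (scalar_atZ bl).
- by rewrite (tlift_linear bil) bl.
- exact: tpair_scalar.
Qed.

(** Elements of the tensor square are thus functions on pairs, and all the
    bialgebra axioms for [R] reduce to identities in the monoid. *)
Lemma ev2_inj (x y : tensor R R) :
  (forall u v, tpair (ev u) (ev v) x = tpair (ev u) (ev v) y) -> x = y.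
Proof.
move=> xy; apply: (tensor_separated_eq ev_scalar ev_separates) => u.
apply: repr_fun_ext => v.
by have := xy u v; rewrite -!ev_tensor.
Qed.

Lemma ev3_inj (x y : tensor R (tensor R R)) :
  (forall u v w, tpair (ev u) (tpair (ev v) (ev w)) x =
                 tpair (ev u) (tpair (ev v) (ev w)) y) -> x = y.
Proof.
move=> xy; apply: (tensor_separated_eq ev_scalar ev_separates) => u.
apply: ev2_inj => v w.
by have := xy u v w; rewrite -!ev_tensor //; exact: tpair_scalar.
Qed.

(** The dual of the multiplication of [N] lands in the tensor square of the
    representative functions; by [ev2_inj] the element [x] is unique. *)
Lemma repr_comul_exists f :
  exists x : tensor R R, forall u v, tpair (ev u) (ev v) x = f (u * v)%g.
Proof.
have [I [p [q [pqR fE]]]] := representative_splits (repr_funP f).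
exists (\sum_i to_repr (pqR i).1 ⊗ to_repr (pqR i).2) => u v; rewrite fE.
have uv := tpair_scalar (ev_scalar u) (ev_scalar v).
elim/big_ind2: _ => [|a x b y <- <-|i _]; last by rewrite tpair_pure.
- exact: scalar_at0 uv.
- exact: scalar_atD uv _ _.
Qed.

Definition repr_comul f : tensor R R := projT1 (cid (repr_comul_exists f)).

Lemma repr_comulE f u v : tpair (ev u) (ev v) (repr_comul f) = f (u * v)%g.
Proof. by rewrite /repr_comul; case: cid. Qed.

Lemma repr_comul_linear : linear repr_comul.
Proof.
move=> k f g; apply: ev2_inj => u v.
by rewrite tpair_scalar // !repr_comulE.
Qed.

HB.instance Definition _ :=
  GRing.isLinear.Build K R (tensor R R) *:%R repr_comul repr_comul_linear.

Definition repr_counit : R -> K := ev 1%g.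

Lemma repr_counit_scalar : scalar repr_counit.
Proof. by []. Qed.

HB.instance Definition _ :=
  GRing.isLinear.Build K R K *%R repr_counit repr_counit_scalar.

Lemma repr_comulA f :
  tassoc (tmap repr_comul idfun (repr_comul f)) =
  tmap idfun repr_comul (repr_comul f).
Proof.
apply: ev3_inj => u v w.
have uvl := tpair_scalar (ev_scalar u) (ev_scalar v).
have vwl := tpair_scalar (ev_scalar v) (ev_scalar w).
rewrite tpair_tassoc // !tpair_tmap //; try exact: repr_comul_linear.
rewrite (eq_tpair (a' := ev (u * v)%g) (b' := ev w)) ?repr_comulE //; last first.
  by move=> g; rewrite /= repr_comulE.
rewrite (eq_tpair (a' := ev u) (b' := ev (v * w)%g)) ?repr_comulE ?mulgA //.
by move=> g; rewrite /= repr_comulE.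
Qed.

Lemma repr_counitl f : tlift (fun g h => repr_counit g *: h) (repr_comul f) = f.
Proof.
apply: repr_fun_ext => u.
have := @ev_tensor R (ev u) 1%g (repr_comul f) (ev_scalar u).
by rewrite repr_comulE mul1g.
Qed.

Lemma repr_counitr f : tlift (fun g h => repr_counit h *: g) (repr_comul f) = f.
Proof.
apply: repr_fun_ext => u; rewrite -[in RHS](mulg1 u) -repr_comulE.
rewrite -[LHS]/(ev u _); move: {f}(repr_comul f).
have bil : bilinear_for *:%R *:%R (fun g h => repr_counit h *: g).
  split=> [h|g] k x y /=; first by rewrite scalerDr !scalerA mulrC.
  by rewrite scalerA -scalerDl.
apply: tpair_ext => [k x y||g h]; first by rewrite (tlift_linear bil).
  exact: tpair_scalar.
by rewrite (tlift_pure bil) tpair_pure // mulrC.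
Qed.

HB.instance Definition _ := isCoalgebra.Build K R
  repr_comulA repr_counitl repr_counitr.

Lemma repr_comul_monoid_morphism :
  GRing.monoid_morphism (comul : R -> tensor R R).
Proof.
split=> [|f g]; apply: ev2_inj => u v; rewrite ?repr_comulE.
  by rewrite one_pure tpair_pure // !(ev_monoid_morphism _).1 mulr1.
by rewrite tpairM //  !repr_comulE.
Qed.

Lemma repr_counit_monoid_morphism : GRing.monoid_morphism (counit : R -> K).
Proof. by []. Qed.

HB.instance Definition _ := isBialgebra.Build K R
  repr_comul_monoid_morphism repr_counit_monoid_morphism.

End ReprCoalgebra.

(** * Bialgebra morphisms into representative functions *)

Section Corepresentation.
Variables (K : fieldType) (N : monoidType) (B : bialgType K).
Local Notation R := (repr_fun K N).

(** A monoid morphism from [N] to the algebra characters of [B], which form a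
    monoid under convolution. *)
Definition character_family (chi : N -> B -> K) : Prop :=
  [/\ forall u, scalar (chi u), forall u, GRing.monoid_morphism (chi u),
      chi 1%g =1 counit & forall u v, chi (u * v)%g =1 conv (chi u) (chi v)].

Lemma hom_character_family (h : bialg_hom B R) :
  character_family (fun u b => h b u).
Proof.
case: h => h [hl [h1 hM] [hD he]] /=; split=> [u k x y|u|b|u v b].
- by rewrite hl.
- by split=> [|x y]; rewrite ?h1 ?hM.
- exact: he.
- by rewrite -(repr_comulE (h b)) -[repr_comul _]/(comul (h b)) -hD tpair_tmap.
Qed.

Section Induced.
Variable chi : N -> B -> K.
Hypothesis chiP : character_family chi.

(** The functions [u |-> chi u b], for [b] in [B], are stable under splitting:
    the comultiplication of [B] splits [b], and with it the function. *)
Lemma character_family_representative b : representative (fun u => chi u b).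
Proof.
exists (fun f => exists b, f = fun u => chi u b); last by exists b.
have [_ _ _ chiM] := chiP.
move=> _ [{}b ->]; set s := trepr (comul b).
exists 'I_(size s), (fun (i : 'I_(size s)) u => chi u (nth (0, 0) s i).1),
  (fun (i : 'I_(size s)) u => chi u (nth (0, 0) s i).2); split=> [i|u v].
  by split; [exists (nth (0, 0) s i).1|exists (nth (0, 0) s i).2].
by rewrite chiM /conv /tpair /tlift (big_nth (0, 0)) big_mkord.
Qed.

Definition induced_fun b : R := to_repr (character_family_representative b).

Lemma induced_bialg_morphism : bialg_morphism induced_fun.
Proof.
have [chil chimor chi1 chiM] := chiP.
have indl : linear induced_fun.
  by move=> k x y; apply: repr_fun_ext => u; exact: chil.
split=> //.
- by split=> [|x y]; apply: repr_fun_ext => u;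
    [exact: (chimor u).1|exact: (chimor u).2].
- split=> b; last exact: chi1.
  apply: ev2_inj => u v; rewrite repr_comulE tpair_tmap //.
  by rewrite /= chiM.
Qed.

Definition induced_hom : bialg_hom B R := BialgHom induced_bialg_morphism.

End Induced.
End Corepresentation.

Section ReprMap.
Variables (K : fieldType) (N N' : monoidType) (h : N -> N').
Hypotheses (h1 : h 1%g = 1%g) (hM : {morph h : u v / (u * v)%g}).

Lemma restriction_family :
  character_family (fun u (f : repr_fun K N') => f (h u)).
Proof.
split=> // [f|u v f]; first by rewrite h1.
by rewrite hM /conv (repr_comulE f).
Qed.

Definition repr_map : bialg_hom (repr_fun K N') (repr_fun K N) :=
  induced_hom restriction_family.

End ReprMap.

(** * Free monoids *)

HB.instance Definition _ (T : choiceType) :=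
  isMonoid.Build (seq T) (@catA T) (@cat0s T) (@cats0 T).

Section FreeMonoid.
Variables (K : fieldType) (T : choiceType) (B : bialgType K).
Implicit Types (t : T) (w : seq T).

(** The uniqueness half of the universal property of the free monoid. *)
Lemma character_family_eq (chi chi' : seq T -> B -> K) :
  character_family chi -> character_family chi' ->
  (forall t, chi [:: t] =1 chi' [:: t]) -> forall w, chi w =1 chi' w.
Proof.
move=> [_ _ chi1 chiM] [_ _ chi'1 chi'M] chichi'; elim=> [|t w IHw] b.
  by rewrite [LHS]chi1 [RHS]chi'1.
rewrite -[t :: w]/([:: t] * w)%g chiM chi'M; exact: eq_conv.
Qed.

Variable alpha : T -> B -> K.
Hypotheses (alpha_scalar : forall t, scalar (alpha t))
  (alpha_morphism : forall t, GRing.monoid_morphism (alpha t)).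

(** The morphism out of the free monoid that extends [alpha], that is, the
    convolution product of the characters of the letters. *)
Definition word_character w : B -> K :=
  foldr (fun t chi => conv (alpha t) chi) counit w.

Lemma word_characterP : character_family word_character.
Proof.
have wl w : scalar (word_character w).
  by elim: w => [|t w IHw]; [exact: counit_scalar|exact: conv_scalar].
split=> // [w|u v].
  elim: w => [|t w IHw]; first exact: counit_monoid_morphism.
  exact: conv_monoid_morphism.
rewrite -[(u * v)%g]/(u ++ v).
elim: u => [|t u IHu] b /=; first by rewrite conv1l.
by rewrite -convA //; exact: eq_conv.
Qed.

Lemma word_character1 t : word_character [:: t] =1 alpha t.
Proof. exact: conv1r. Qed.

End FreeMonoid.

Section Coproduct.
Variables (K : fieldType) (T1 T2 : choiceType).
Local Notation T := (T1 + T2)%type.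
Local Notation R1 := (repr_fun K (seq T1)).
Local Notation R2 := (repr_fun K (seq T2)).
Local Notation R := (repr_fun K (seq T)).

Definition inlw (w : seq T1) : seq T := map inl w.
Definition inrw (w : seq T2) : seq T := map inr w.
Definition lpart (w : seq T) : seq T1 :=
  pmap (fun t => if t is inl x then Some x else None) w.
Definition rpart (w : seq T) : seq T2 :=
  pmap (fun t => if t is inr x then Some x else None) w.
Definition parts (w : seq T) : seq T1 * seq T2 := (lpart w, rpart w).

Lemma inlwM : {morph inlw : u v / (u * v)%g}. Proof. exact: map_cat. Qed.
Lemma inrwM : {morph inrw : u v / (u * v)%g}. Proof. exact: map_cat. Qed.
Lemma lpartM : {morph lpart : u v / (u * v)%g}. Proof. exact: pmap_cat. Qed.
Lemma rpartM : {morph rpart : u v / (u * v)%g}. Proof. exact: pmap_cat. Qed.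
Lemma partsM : {morph parts : u v / (u * v)%g}.
Proof. by move=> u v; rewrite /parts lpartM rpartM. Qed.

Lemma inlwK : cancel inlw lpart. Proof. exact: (map_pK (fun=> erefl)). Qed.
Lemma inrwK : cancel inrw rpart. Proof. exact: (map_pK (fun=> erefl)). Qed.
Lemma rpart_inlw w : rpart (inlw w) = [::]. Proof. by elim: w. Qed.
Lemma lpart_inrw w : lpart (inrw w) = [::]. Proof. by elim: w. Qed.

Lemma parts_inw u v : parts (inlw u * inrw v)%g = (u, v).
Proof.
by rewrite /parts lpartM rpartM inlwK inrwK lpart_inrw rpart_inlw mulg1 mul1g.
Qed.

Definition restrl : bialg_hom R R1 :=
  repr_map K (erefl : inlw 1%g = 1%g) inlwM.
Definition restrr : bialg_hom R R2 :=
  repr_map K (erefl : inrw 1%g = 1%g) inrwM.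
Definition inflatel : bialg_hom R1 R :=
  repr_map K (erefl : lpart 1%g = 1%g) lpartM.
Definition inflater : bialg_hom R2 R :=
  repr_map K (erefl : rpart 1%g = 1%g) rpartM.
Definition inflate_parts : bialg_hom (repr_fun K (seq T1 * seq T2)%type) R :=
  repr_map K (erefl : parts 1%g = 1%g) partsM.

(** Morphisms from [B] to [R], [R1] and [R2] are families of characters indexed
    by [T], [T1] and [T2]; a family on [T1 + T2] is a pair of families. *)
Lemma repr_product (B : bialgType K) (f : bialg_hom B R1) (g : bialg_hom B R2) :
  exists! u : bialg_hom B R, bialg_comp restrl u = f /\ bialg_comp restrr u = g.
Proof.
have [fl fm _ _] := hom_character_family f.
have [gl gm _ _] := hom_character_family g.
pose alpha (t : T) (b : B) : K :=
  match t with inl x => f b [:: x] | inr y => g b [:: y] end.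
have al t : scalar (alpha t) by case: t => ? /=; [exact: fl|exact: gl].
have am t : GRing.monoid_morphism (alpha t).
  by case: t => ? /=; [exact: fm|exact: gm].
pose h := induced_hom (word_characterP al am).
exists h; split.
  split; apply: bialg_hom_ext => b; apply: repr_fun_ext => w.
    apply: (character_family_eq (hom_character_family (bialg_comp restrl h))
      (hom_character_family f)) => t {}b.
    exact: word_character1.
  apply: (character_family_eq (hom_character_family (bialg_comp restrr h))
    (hom_character_family g)) => t {}b.
  exact: word_character1.
move=> h' [hf hg]; apply: bialg_hom_ext => b; apply: repr_fun_ext => w.
apply: (character_family_eq (word_characterP al am) (hom_character_family h')).
by case=> t {}b; rewrite word_character1 //= -?hf -?hg.
Qed.

Lemma restrl_inflatel : bialg_comp restrl inflatel = bialg_id R1.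
Proof.
by apply: bialg_hom_ext => f; apply: repr_fun_ext => w; rewrite /= inlwK.
Qed.

Lemma restrr_inflater : bialg_comp restrr inflater = bialg_id R2.
Proof.
by apply: bialg_hom_ext => f; apply: repr_fun_ext => w; rewrite /= inrwK.
Qed.

Lemma restrl_inflater :
  bialg_comp restrl inflater = bialg_comp (bialg_unit R1) (bialg_counit R2).
Proof.
apply: bialg_hom_ext => f; apply: repr_fun_ext => w /=; rewrite rpart_inlw.
exact/esym/mulr1.
Qed.

Lemma restrr_inflatel :
  bialg_comp restrr inflatel = bialg_comp (bialg_unit R2) (bialg_counit R1).
Proof.
apply: bialg_hom_ext => f; apply: repr_fun_ext => w /=; rewrite lpart_inrw.
exact/esym/mulr1.
Qed.

(** Restriction along a surjective map of monoids is injective. *)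
Lemma inflate_parts_inj : injective inflate_parts.
Proof.
move=> f g fg; apply: repr_fun_ext => -[u v].
by have /= := congr1 (fun h : R => h (inlw u * inrw v)%g) fg; rewrite !parts_inw.
Qed.

(** A nonempty product [u * v] starts like [u], and like [v] when [u] is empty;
    hence this function, the indicator of the empty word and the constant 1 span
    a subcoalgebra. *)
Lemma starts_left_representative :
  representative (fun w : seq T => if w is inl _ :: _ then 1 else 0 : K).
Proof.
set hd := (X in representative X).
pose nil_ind (w : seq T) : K := if w is [::] then 1 else 0.
exists (fun f => [\/ f = hd, f = nil_ind | f = fun=> 1]); last by constructor.
move=> f [] ->.
- exists bool, (fun b => if b then hd else nil_ind),
    (fun b => if b then fun=> 1 else hd).
  split=> [[]|u v]; first by split; [constructor 1|constructor 3].
    by split; [constructor 2|constructor 1].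
  rewrite big_bool /=.
  by case: u => [|[t|t] u] /=; rewrite ?(mul0r, mulr1, add0r, addr0, mul1r).
- exists unit, (fun=> nil_ind), (fun=> nil_ind).
  split=> [_|u v]; first by split; constructor 2.
  rewrite (big_pred1 tt) /=; last by case.
  by case: u => [|t u] /=; rewrite ?(mul0r, mul1r).
- exists unit, (fun _ _ => 1), (fun _ _ => 1).
  split=> [_|u v]; first by split; constructor 3.
  by rewrite (big_pred1 tt) ?mulr1 //; case.
Qed.

(** The words [t1 t2] and [t2 t1] have the same parts. *)
Lemma inflate_parts_not_surj (t1 : T1) (t2 : T2)
    (f : repr_fun K (seq T1 * seq T2)%type) :
  inflate_parts f <> to_repr starts_left_representative.
Proof.
move=> fE; have := congr1 (fun h : R => h [:: inl t1; inr t2]) fE.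
have := congr1 (fun h : R => h [:: inr t2; inl t1]) fE.
by move=> /= -> /eqP; rewrite eq_sym oner_eq0.
Qed.

End Coproduct.

(** * Protomodularity of the zero object *)

Section ZeroObject.
Variables (C : pointedCategory).

(** The pair [(k, s)] belongs to the pullback along [W -> 0] of the split
    extension [X = X -> 0], since pullbacks over the zero object are products. *)
Lemma protomodular_zero_product (W X P : C)
    (p1 : hom P W) (p2 : hom P X) (k : hom X P) (s : hom W P) :
  (forall (Z : C) (a : hom Z W) (b : hom Z X),
     exists! u : hom Z P, p1 ∘ u = a /\ p2 ∘ u = b) ->
  p1 ∘ k = zero_mor X W -> p2 ∘ k = idm X ->
  p1 ∘ s = idm W -> p2 ∘ s = zero_mor W X ->
  protomodular_object (zero_obj (p := C)) -> jointly_extremally_epic k s.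
Proof.
move=> prod p1k p2k p1s p2s proto.
have to0 (Z : C) (a b : hom Z zero_obj) : a = b.
  by rewrite (to_zero_uniq a) (to_zero_uniq b).
have zeroE (Z Y : C) (h : hom Z zero_obj) : from_zero Y ∘ h = zero_mor Z Y.
  by rewrite (to0 _ h (to_zero Z)).
have kerX : is_kernel (idm X) (to_zero X).
  split=> [|Z h _]; first exact: to0.
  by exists h; split=> [|h' <-]; rewrite comp_id_l.
have splitX : to_zero X ∘ from_zero X = idm zero_obj by exact: to0.
have kerP : is_kernel k p1.
  split=> // Z h p1h; exists (p2 ∘ h); split=> [|h' <-]; last first.
    by rewrite comp_assoc p2k comp_id_l.
  have [u [_ uniq_u]] := prod Z (p1 ∘ h) (p2 ∘ h).
  rewrite -[RHS](uniq_u h) // -(uniq_u (k ∘ (p2 ∘ h))) //; split; last first.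
    by rewrite comp_assoc p2k comp_id_l.
  by rewrite comp_assoc p1k p1h /zero_mor -comp_assoc zeroE.
apply: (proto (SplitExtension kerX splitX) W (to_zero W)
  (SplitExtension kerP p1s)).
exists p2; split; last exact: p2s.
by split=> [|Z a b _]; [exact: to0|exact: prod].
Qed.

End ZeroObject.

Theorem mainTheorem5 (K : fieldType) :
  ~ protomodular_object (C := BiAlg K) (base_bialg K).
Proof.
(* One letter on each side suffices. *)
move=> /(@protomodular_zero_product (BiAlg K) _ _ _ (restrl K unit unit)
  (restrr K unit unit) (inflater K unit unit) (inflatel K unit unit)) epi.
have {epi} := epi (@repr_product K unit unit) (restrl_inflater K unit unit)
  (restrr_inflater K unit unit) (restrl_inflatel K unit unit)
  (restrr_inflatel K unit unit).
move=> /(_ _ (inflate_parts K unit unit)) [].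
- move=> Z u v uv; apply: bialg_hom_ext => b.
  apply: (@inflate_parts_inj K unit unit).
  exact: (congr1 (fun h : bialg_hom _ _ => h b) uv).
- exists (@repr_map K (seq unit * seq unit)%type (seq unit) snd erefl
    (fun _ _ => erefl)).
  by apply: bialg_hom_ext => f; apply: repr_fun_ext.
- exists (@repr_map K (seq unit * seq unit)%type (seq unit) fst erefl
    (fun _ _ => erefl)).
  by apply: bialg_hom_ext => f; apply: repr_fun_ext.
move=> g [_ /(congr1 (fun h : bialg_hom _ _ =>
  h (to_repr (starts_left_representative K unit unit))))].
exact: inflate_parts_not_surj tt tt _.
Qed.
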